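(* Let $m_1,m_2\geq 1$ and $m_3\geq 2$ be integers. Then \begin{align*} S_{1m_1m_2,m_3}=&(-1)^{m_3-1}\sum_{i=1}^{m_3-2}(-1)^{i-1}\zeta(m_3-i)S_{m_1m_2,i+1}\\ &+(-1)^{m_3}\big(S_{m_1,m_2+1}+S_{m_2,m_1+1}-\zeta(m_1+m_2+1)\big)\zeta(m_3)\\ &+(-1)^{m_3}\Big\{\sum_{i=1}^{m_2-1}(-1)^{i-1}S_{m_1,m_2+1-i}\,\zeta(m_3,i)+\sum_{i=1}^{m_1-1}(-1)^{i-1}S_{m_2,m_1+1-i}\,\zeta(m_3,i)\Big\}\\ &+(-1)^{m_3}\Big\{(-1)^{m_2-1}\zeta(m_1+1)\zeta(m_3,m_2)+(-1)^{m_1-1}\zeta(m_2+1)\zeta(m_3,m_1)\Big\}\\ &+(-1)^{m_3}\Big\{(-1)^{m_2-1}\sum_{i=1}^{m_1-1}(-1)^{i-1}\zeta(m_1+1-i)\zeta(m_3,m_2,i)\\ &\qquad\qquad+(-1)^{m_1-1}\sum_{i=1}^{m_2-1}(-1)^{i-1}\zeta(m_2+1-i)\zeta(m_3,m_1,i)\Big\}\\ &+(-1)^{m_1+m_2+m_3}\Big\{\zeta(m_3,m_2,m_1,1)+\zeta(m_3,m_1,m_2,1)+\zeta(m_3,m_2,m_1+1)\\ &\qquad\qquad+\zeta(m_3,m_1,m_2+1)+\zeta(m_3,m_1+m_2,1)+\zeta(m_3,m_1+m_2+1)\Big\}\\ &-(-1)^{m_3}\sum_{i=1}^{m_1+m_2-1}(-1)^{i-1}\zeta(m_1+m_2+1-i)\zeta(m_3,i).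 \end{align*}
   Context: For positive integers $k$ and $n\ge0$, $H_n^{(k)}=\sum_{j=1}^n j^{-k}$ and $H_n=H_n^{(1)}$. For positive integers $s_1,\dots,s_r$ and $q\ge 2$, $S_{s_1\cdots s_r,q}=\sum_{n=1}^\infty H_n^{(s_1)}\cdots H_n^{(s_r)}/n^q$; e.g. $S_{1m_1m_2,m_3}=\sum_{n\ge1}H_nH_n^{(m_1)}H_n^{(m_2)}/n^{m_3}$, $S_{m_1m_2,q}=\sum_{n\ge1}H_n^{(m_1)}H_n^{(m_2)}/n^q$, $S_{p,q}=\sum_{n\ge1}H_n^{(p)}/n^q$. For positive integers $s_1\ge2,s_2,\dots,s_k$, the multiple zeta value is $\zeta(s_1,\dots,s_k)=\sum_{n_1>n_2>\cdots>n_k\ge1}n_1^{-s_1}\cdots n_k^{-s_k}$; for $k=1$ this is the Riemann zeta function. Empty sums are $0$. *)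

(* Defs.v *)
From mathcomp Require Import all_boot all_order all_algebra.
From mathcomp Require Import all_classical all_reals all_analysis.

Set Implicit Arguments.
Unset Strict Implicit.
Unset Printing Implicit Defensive.

Import Order.TTheory GRing.Theory Num.Theory.
Import numFieldNormedType.Exports.

Local Open Scope classical_set_scope.
Local Open Scope ring_scope.

Section EulerSums.
Variable R : realType.

(* H_n^(k) *)
Definition gharm (k n : nat) : R := \sum_(1 <= j < n.+1) j%:R ^- k.

(* S_{s_1...s_r, q}; meaningful for q >= 2, where the series converges. *)
Definition euler_sum (s : seq nat) (q : nat) : R :=
  \big[+%R/0]_(1 <= n <oo) ((\prod_(k <- s) gharm k n) / n%:R ^+ q).

(* mzv_trunc [:: s_1; ...; s_k] N is the finite sum, over all integers
   N > n_1 > n_2 > ... > n_k >= 1, of n_1^-s_1 * ... * n_k^-s_k. *)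
Fixpoint mzv_trunc (s : seq nat) (N : nat) : R :=
  if s is k :: s' then \sum_(1 <= n < N) n%:R ^- k * mzv_trunc s' n else 1.

(* zeta(s_1, ..., s_k); meaningful for s_1 >= 2, where the limit exists. *)
Definition mzv (s : seq nat) : R := limn (mzv_trunc s).

End EulerSums.

Arguments gharm {R} k n.
Arguments euler_sum {R} s q.
Arguments mzv_trunc {R} s N.
Arguments mzv {R} s.

(* Main.v *)
(* Write f(n) = H_n^(m1) H_n^(m2) and sum f(n) / (n k^(m3-1) (n+k)) over all
   n, k >= 1 in both orders. Summing over k first, partial fractions in k and
   sum_k (1/k - 1/(n+k)) = H_n give zeta values times the S_{m1 m2, i+1}, plus
   (-1)^m3 S_{1 m1 m2, m3}. Summing over n first, summation by parts turns
   sum_n f(n) (1/n - 1/(n+k)) into the sum over 0 <= j < k of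
   sum_n (f(n) - f(n-1)) / (n+j); since f(n) - f(n-1) is
   H_n^(m1)/n^m2 + H_n^(m2)/n^m1 - 1/n^(m1+m2), partial fractions in n and the
   same argument for a single harmonic number, and then for the constant 1,
   reduce everything to linear combinations of nested sums over k > j > l > ...,
   that is, of multiple zeta values. All the series converge because every power
   of H_n is O(sqrt n). *)
Require Import Defs.
From mathcomp Require Import all_boot all_order all_algebra.
From mathcomp Require Import all_classical all_reals all_analysis.
From mathcomp Require Import ring lra.

Set Implicit Arguments.
Unset Strict Implicit.
Unset Printing Implicit Defensive.

Import Order.TTheory GRing.Theory Num.Theory.
Import numFieldNormedType.Exports.

Local Open Scope classical_set_scope.
Local Open Scope ring_scope.

(** * Nested sums over strictly decreasing indices, and their limits *)

Section NestedSums.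
Variable R : realType.
Implicit Types (s : seq nat) (u v : nat -> R) (l : R).

(* nested_sum [:: s_1; ...; s_k] u N is the sum, over all integers
   N > n_1 > ... > n_k > n >= 1, of n_1^-s_1 * ... * n_k^-s_k * u n. *)
Fixpoint nested_sum s u (N : nat) : R :=
  if s is k :: s' then \sum_(1 <= n < N) n%:R ^- k * nested_sum s' u n
  else \sum_(1 <= n < N) u n.

(** Keeping the outer exponents [s] as a parameter lets a function of the innermost index be
    expanded linearly while the outer summations stay fixed. *)
Definition nested_sums_to s u l : Prop := nested_sum s u @ \oo --> l.

Notation sums_to := (nested_sums_to [::]).

Lemma eq_nested_sum s u v : (forall n, (0 < n)%N -> u n = v n) ->
  nested_sum s u = nested_sum s v.
Proof.
move=> uv; elim: s => [|k s /= ->//]; apply/funext => N /=.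
by apply: eq_big_nat => n /andP[/uv].
Qed.

Lemma nested_sumD s u v N :
  nested_sum s (fun n => u n + v n) N = nested_sum s u N + nested_sum s v N.
Proof.
elim: s N => [|k s IH] N /=; first by rewrite big_split.
by rewrite -big_split; apply: eq_bigr => n _; rewrite IH mulrDr.
Qed.

Lemma nested_sumZ s c u N :
  nested_sum s (fun n => c * u n) N = c * nested_sum s u N.
Proof.
elim: s N => [|k s IH] N /=; first by rewrite mulr_sumr.
by rewrite mulr_sumr; apply: eq_bigr => n _; rewrite IH mulrCA.
Qed.

Lemma nested_sum_rcons s p u : nested_sum (rcons s p) u =
  nested_sum s (fun n => n%:R ^- p * \sum_(1 <= j < n) u j).
Proof. by elim: s => [|k s /= ->]. Qed.

Lemma nested_sum_mzv_trunc s i t :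
  nested_sum s (fun n => n%:R ^- i * mzv_trunc t n) = mzv_trunc (s ++ i :: t).
Proof. by elim: s => [|k s /= ->]. Qed.

Lemma eq_nested_sums_to s u v l : (forall n, (0 < n)%N -> u n = v n) ->
  nested_sums_to s u l -> nested_sums_to s v l.
Proof. by move=> uv; rewrite /nested_sums_to (eq_nested_sum s uv). Qed.

Lemma nested_sums_toD s u v l l' : nested_sums_to s u l ->
  nested_sums_to s v l' -> nested_sums_to s (fun n => u n + v n) (l + l').
Proof.
move=> ul vl; rewrite /nested_sums_to.
have -> : nested_sum s (fun n => u n + v n) =
    (fun N => nested_sum s u N + nested_sum s v N).
  by apply/funext => N; exact: nested_sumD.
exact: cvgD.
Qed.

Lemma nested_sums_toZ s c u l :
  nested_sums_to s u l -> nested_sums_to s (fun n => c * u n) (c * l).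
Proof.
move=> ul; rewrite /nested_sums_to.
have -> : nested_sum s (fun n => c * u n) = (fun N => c * nested_sum s u N).
  by apply/funext => N; exact: nested_sumZ.
exact: cvgMl_tmp.
Qed.

Lemma nested_sums_toB s u v l l' : nested_sums_to s u l ->
  nested_sums_to s v l' -> nested_sums_to s (fun n => u n - v n) (l - l').
Proof.
move=> ul vl; have := nested_sums_toD ul (@nested_sums_toZ s (-1) _ _ vl).
by rewrite mulN1r; apply: eq_nested_sums_to => n _; rewrite mulN1r.
Qed.

Lemma nested_sums_to_0 s : nested_sums_to s (fun=> 0) 0.
Proof.
suff h N : nested_sum s (fun=> 0) N = 0.
  by rewrite /nested_sums_to (funext h); exact: cvg_cst.
by have := @nested_sumZ s 0 (fun=> 0) N; rewrite !mul0r.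
Qed.

Lemma nested_sums_to_sum s (a b : nat) (w : nat -> nat -> R) (l : nat -> R) :
  (forall i, (a <= i < b)%N -> nested_sums_to s (w i) (l i)) ->
  nested_sums_to s (fun n => \sum_(a <= i < b) w i n) (\sum_(a <= i < b) l i).
Proof.
elim: b => [|b IH] wl.
  rewrite big_geq//; apply: eq_nested_sums_to (nested_sums_to_0 s) => n _.
  by rewrite big_geq.
have [ab|ba] := leqP a b; last first.
  rewrite big_geq//; apply: eq_nested_sums_to (nested_sums_to_0 s) => n _.
  by rewrite big_geq.
rewrite big_nat_recr//=.
have := nested_sums_toD (IH _) (wl b _); rewrite ab ltnSn => /(_ _ isT) h.
apply: eq_nested_sums_to (h _) => [n _|i /andP[ai ib]].
  by rewrite big_nat_recr.
by apply: wl; rewrite ai ltnW.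
Qed.

Lemma sums_to_cvg0 u l : sums_to u l -> u @ \oo --> (0 : R).
Proof.
move=> ul.
have ul1 : (fun N : nat => \sum_(1 <= n < N.+1) u n) @ \oo --> l.
  by rewrite (cvg_shiftS (nested_sum [::] u)).
have ul2 : (fun N : nat => \sum_(1 <= n < N.+2) u n) @ \oo --> l.
  by rewrite (cvg_shiftS (fun N : nat => \sum_(1 <= n < N.+1) u n)).
suff : (fun N : nat => u N.+1) @ \oo --> (0 : R) by rewrite (cvg_shiftS u).
have -> : (fun N : nat => u N.+1) =
    (fun N : nat => \sum_(1 <= n < N.+2) u n - \sum_(1 <= n < N.+1) u n).
  by apply/funext => N; rewrite [in RHS]big_nat_recr//= [RHS]addrC addKr.
have : (fun N : nat => \sum_(1 <= n < N.+2) u n - \sum_(1 <= n < N.+1) u n)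
    @ \oo --> l - l by exact: (cvgB ul2 ul1).
by rewrite subrr.
Qed.

Lemma sum_from1_nondecreasing u : (forall n, (0 < n)%N -> 0 <= u n) ->
  {homo (fun N : nat => \sum_(1 <= n < N) u n) : m n / (m <= n)%N >-> m <= n}.
Proof.
move=> u0; apply: homo_leq => [x|y x z|[|N]]; first exact: lexx.
- exact: le_trans.
- by rewrite !big_geq.
- by rewrite [leRHS]big_nat_recr//= lerDl u0.
Qed.

Lemma sums_to_ge u l N : (forall n, (0 < n)%N -> 0 <= u n) -> sums_to u l ->
  \sum_(1 <= n < N) u n <= l.
Proof.
move=> u0 ul; apply: (cvgr_to_ge ul); exists N => //= M NM.
exact: sum_from1_nondecreasing.
Qed.

Lemma bounded_sums_to u B : (forall n, (0 < n)%N -> 0 <= u n) ->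
  (forall N, \sum_(1 <= n < N) u n <= B) ->
  sums_to u (limn (fun N : nat => \sum_(1 <= n < N) u n)).
Proof.
move=> u0 uB; apply: nondecreasing_is_cvgn; first exact: sum_from1_nondecreasing.
by exists B => _ [N _ <-]; exact: uB.
Qed.

(** One half of Tonelli's theorem: the first N rows truncated at column K are bounded, column by
    column, by the partial sums of [c]; K tends to infinity first, then N. Applied to the transposed
    array it gives the reverse inequality. *)
Lemma sums_to_exchange_le (a : nat -> nat -> R) (r c : nat -> R) lr lc :
  (forall n k, (0 < n)%N -> (0 < k)%N -> 0 <= a n k) ->
  (forall n, (0 < n)%N -> sums_to (a n) (r n)) ->
  (forall k, (0 < k)%N -> sums_to (a ^~ k) (c k)) ->
  sums_to r lr -> sums_to c lc -> lr <= lc.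
Proof.
move=> a0 ar ac rl cl; apply: (cvgr_to_le rl); apply: nearW => N.
have aN : sums_to (fun k => \sum_(1 <= n < N) a n k) (\sum_(1 <= n < N) r n).
  by apply: nested_sums_to_sum => n /andP[n0 _]; exact: ar.
apply: (ler_cvg_to aN cl); apply: nearW => K; apply: ler_sum_nat => k /andP[k0 _].
by apply: sums_to_ge (ac k k0) => n n0; exact: a0.
Qed.

Lemma sums_to_exchange (a : nat -> nat -> R) (r c : nat -> R) lr lc :
  (forall n k, (0 < n)%N -> (0 < k)%N -> 0 <= a n k) ->
  (forall n, (0 < n)%N -> sums_to (a n) (r n)) ->
  (forall k, (0 < k)%N -> sums_to (a ^~ k) (c k)) ->
  sums_to r lr -> sums_to c lc -> lr = lc.
Proof.
move=> a0 ar ac rl cl; apply/eqP; rewrite eq_le.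
rewrite (sums_to_exchange_le a0 ar ac rl cl)/=.
by apply: (@sums_to_exchange_le (fun k n => a n k) c r) => // n k n0 k0; exact: a0.
Qed.

End NestedSums.

Notation sums_to := (nested_sums_to [::]).

(** * Growth of powers of harmonic numbers *)

Section Growth.
Variable R : realType.

Lemma gharm0 k : gharm k 0 = 0 :> R.
Proof. by rewrite /gharm big_geq. Qed.

Lemma gharmS k n : gharm k n.+1 = gharm k n + n.+1%:R ^- k :> R.
Proof. by rewrite /gharm big_nat_recr. Qed.

Lemma gharm_ge0 k n : 0 <= gharm k n :> R.
Proof. by apply: sumr_ge0 => j _; rewrite invr_ge0 exprn_ge0. Qed.

Lemma invrX_le (k j : nat) : (0 < k)%N -> (0 < j)%N -> j%:R ^- k <= j%:R^-1 :> R.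
Proof.
move=> k0 j0; rewrite lef_pV2 ?posrE ?exprn_gt0 ?ltr0n//.
by rewrite -[leLHS]expr1 ler_weXn2l// ler1n.
Qed.

Lemma gharm_le1 k n : (0 < k)%N -> gharm k n <= gharm 1 n :> R.
Proof.
move=> k0; apply: ler_sum_nat => j /andP[j0 _].
by rewrite expr1; exact: invrX_le.
Qed.

(* G n grows like the square root of n. *)
Let G (n : nat) : R := \prod_(1 <= j < n.+1) (1 + (2 * j%:R)^-1).

Let GS n : G n.+1 = G n * (1 + (2 * n.+1%:R)^-1).
Proof. by rewrite /G big_nat_recr. Qed.

Let G_ge0 n : 0 <= G n.
Proof. by apply: prodr_ge0 => j _; rewrite addr_ge0// invr_ge0 mulr_ge0. Qed.

(** Convexity: on [0, 1] the graph of (1 + y)^r lies below its chord. In the induction the defect is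
    (2^r - 1) y (1 - y). *)
Let exprD1_le (y : R) r : 0 <= y <= 1 -> (1 + y) ^+ r <= 1 + (2 ^+ r - 1) * y.
Proof.
move=> /andP[y0 y1]; elim: r => [|r IH]; first by rewrite expr0; lra.
have p1 : 1 <= 2 ^+ r :> R by apply: exprn_ege1; lra.
rewrite !exprSr; set p := 2 ^+ r in IH p1 *.
apply: (@le_trans _ _ ((1 + (p - 1) * y) * (1 + y))).
  by apply: ler_wpM2r => //; lra.
have : 0 <= (p - 1) * (y * (1 - y)) by rewrite !mulr_ge0// subr_ge0.
nra.
Qed.

(** The product [P] mediates: the increment of [c * P n] is P n / (n + 1), at least the harmonic
    increment 1 / (n + 1), while [P n ^+ r] is compared with [G n] factor by factor. *)
Lemma harm_pow_le r : exists2 C : R, 0 <= C & forall n, gharm 1 n ^+ r <= C * G n.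
Proof.
(* For y = 1/(c j) the chord bound gives 1 + (2^r - 1)/(2^(r+1) j), which is at most the factor 1 +
   1/(2 j) of [G]. *)
pose c : R := 2 ^+ r.+1.
have c1 : 1 <= c by apply: exprn_ege1; lra.
pose P n : R := \prod_(1 <= j < n.+1) (1 + (c * j%:R)^-1).
have P1 n : 1 <= P n.
  elim: n => [|n IH]; first by rewrite /P big_geq.
  rewrite /P big_nat_recr//= -/(P n) mulr_ege1// lerDl invr_ge0.
  by rewrite mulr_ge0//; lra.
have HP n : gharm 1 n <= c * P n.
  elim: n => [|n IH]; first by rewrite gharm0 mulr_ge0//; [lra|exact: le_trans (P1 _)].
  rewrite gharmS expr1 /P big_nat_recr//= -/(P n) mulrDr mulr1 mulrDr lerD//.
  rewrite invfM mulrCA mulrA mulrA mulfK; last by lra.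
  by rewrite ler_peMl ?invr_ge0.
have PG n : P n ^+ r <= G n.
  elim: n => [|n IH]; first by rewrite /P /G !big_geq// expr1n.
  rewrite /P big_nat_recr//= -/(P n) GS exprMn ler_pM//.
  - by rewrite exprn_ge0//; exact: le_trans (P1 _).
  - by rewrite exprn_ge0// addr_ge0// invr_ge0 mulr_ge0//; lra.
  have n1 : 1 <= n.+1%:R :> R by rewrite ler1n.
  apply: le_trans (exprD1_le _ _) _.
    rewrite invr_ge0 mulr_ge0//; last lra.
    by rewrite invf_le1 ?mulr_gt0//; nra.
  rewrite lerD2l /c exprS -mulrA -[leLHS]mulrC !invfM.
  have q0 : 0 < 2 ^+ r :> R by apply: exprn_gt0.
  have : (2 ^+ r)^-1 * (2 ^+ r - 1) <= 1 :> R.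
    by rewrite mulrBr mulVf ?gt_eqF// mulr1 gerBl invr_ge0 ltW.
  have : 0 < n.+1%:R^-1 :> R by rewrite invr_gt0.
  move: (2 ^+ r) (n.+1%:R^-1) => p q.
  have -> : 2^-1 * (p^-1 * q) * (p - 1) = 2^-1 * q * (p^-1 * (p - 1)) by ring.
  by move=> q1 ?; rewrite ler_piMr// mulr_ge0// ltW.
exists (c ^+ r) => [|n]; first by rewrite exprn_ge0//; lra.
apply: (@le_trans _ _ ((c * P n) ^+ r)).
  by rewrite lerXn2r ?nnegrE ?gharm_ge0// (le_trans (gharm_ge0 _ _) (HP n)).
by rewrite exprMn ler_wpM2l// exprn_ge0//; lra.
Qed.

(* The partial sums telescope: G n / n^2 <= 4 (G n / n - G n.+1 / n.+1). *)
Let sum_G_le N : \sum_(1 <= n < N) G n / n%:R ^+ 2 <= 6.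
Proof.
case: N => [|N]; first by rewrite big_geq.
(* The left side is nonincreasing in [N]; 6 is its initial value 4 G(1), as G(1) = 3/2. *)
suff : \sum_(1 <= n < N.+1) G n / n%:R ^+ 2 + 4 * (G N.+1 / N.+1%:R) <= 6.
  apply: le_trans; rewrite lerDl mulr_ge0// divr_ge0//.
elim: N => [|N IH].
  by rewrite big_geq// GS /G big_geq//; lra.
rewrite big_nat_recr//= (GS N.+1).
apply: le_trans IH; rewrite -addrA lerD2l.
have := G_ge0 N.+1; move: (G N.+1) => g g0.
have N1 : 1 <= N.+1%:R :> R by rewrite ler1n.
rewrite -[N.+2]addn1 natrD; move: (N.+1%:R) N1 => x x1.
rewrite -subr_ge0.
have -> : 4 * (g / x) - (g / x ^+ 2 + 4 * (g * (1 + (2 * (x + 1))^-1) / (x + 1)))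
  = g * (x ^+ 2 + 2 * x - 1) / (x ^+ 2 * (x + 1) ^+ 2).
  by field; apply/andP; split; apply/eqP; lra.
rewrite divr_ge0// mulr_ge0//; first by nra.
by rewrite exprn_ge0//; lra.
by rewrite exprn_ge0//; lra.
Qed.

(** The comparison test behind the convergence of all the multiple zeta values and Euler sums:
    powers of H_n are O([G n]), and the sums of [G n] / n^2 are bounded. *)
Lemma sums_to_dominated (u : nat -> R) r q : (2 <= q)%N ->
  (forall n, (0 < n)%N -> 0 <= u n <= gharm 1 n ^+ r / n%:R ^+ q) ->
  sums_to u (limn (fun N : nat => \sum_(1 <= n < N) u n)).
Proof.
move=> q2 u0; have [C C0 HC] := harm_pow_le r.
apply: (@bounded_sums_to _ _ (C * 6)) => [n /u0 /andP[]//|N].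
apply: (@le_trans _ _ (C * (\sum_(1 <= n < N) G n / n%:R ^+ 2))); last first.
  exact: ler_wpM2l.
rewrite mulr_sumr; apply: ler_sum_nat => n /andP[n0 _].
have /andP[_ /le_trans] := u0 n n0; apply.
rewrite mulrA ler_pM ?exprn_ge0 ?gharm_ge0// ?invr_ge0 ?exprn_ge0//.
by rewrite lef_pV2 ?posrE ?exprn_gt0 ?ltr0n// ler_weXn2l// ler1n.
Qed.

(** The square of this sequence is H_n^(2r) / n^2, the general term of a convergent series, so it
    tends to 0; then take square roots. *)
Lemma harm_pow_div_cvg0 r : (fun n => gharm 1 n ^+ r / n%:R : R) @ \oo --> 0.
Proof.
have /sums_to_cvg0 h : sums_to (fun n => gharm 1 n ^+ (2 * r) / n%:R ^+ 2 : R)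
    (limn (fun N : nat => \sum_(1 <= n < N) (gharm 1 n ^+ (2 * r) / n%:R ^+ 2))).
  apply: (@sums_to_dominated _ (2 * r) 2) => // n _.
  by rewrite lexx divr_ge0// exprn_ge0 ?gharm_ge0.
have -> : (fun n => gharm 1 n ^+ r / n%:R : R) =
    @Num.sqrt R \o (fun n => gharm 1 n ^+ (2 * r) / n%:R ^+ 2).
  apply/funext => n /=; rewrite mulnC exprM -expr_div_n sqrtr_sqr ger0_norm//.
  by rewrite divr_ge0// exprn_ge0// gharm_ge0.
rewrite -[X in _ --> X](@sqrtr0 R).
by apply: continuous_cvg => //; exact: sqrt_continuous.
Qed.

End Growth.

(** * Convergence of multiple zeta values and Euler sums *)

Section Convergence.
Variable R : realType.
Implicit Types (s : seq nat).

Lemma mzv_trunc_ge0 s N : 0 <= mzv_trunc s N :> R.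
Proof.
elim: s N => [//|k s IH] N /=; apply: sumr_ge0 => n _.
by rewrite mulr_ge0// invr_ge0 exprn_ge0.
Qed.

(** Lowering every exponent to 1 and dropping the ordering of the indices leaves a product of
    [size s] harmonic sums. *)
Lemma mzv_trunc_le s N : all (ltn 0) s ->
  mzv_trunc s N <= gharm 1 N ^+ size s :> R.
Proof.
elim: s N => [//|k s IH] N /=/andP[k0 s0].
have nd n : (n < N)%N -> gharm 1 n <= gharm 1 N :> R.
  move=> nN; rewrite /gharm (@big_cat_nat _ _ _ n.+1 1 N.+1)//=; last exact: ltnW.
  by rewrite lerDl sumr_ge0// => j _; rewrite invr_ge0 exprn_ge0.
apply: (@le_trans _ _ (\sum_(1 <= n < N) n%:R ^- 1 * gharm 1 N ^+ size s)).
  apply: ler_sum_nat => n /andP[n0 nN].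
  rewrite ler_pM ?invr_ge0 ?exprn_ge0 ?mzv_trunc_ge0//.
    by rewrite expr1 invrX_le.
  by apply: (le_trans (IH _ s0)); rewrite lerXn2r ?nnegrE ?gharm_ge0 ?nd.
rewrite -mulr_suml exprS ler_wpM2r ?exprn_ge0 ?gharm_ge0// /gharm.
case: N {nd} => [|N]; first by rewrite !big_geq.
by rewrite [leRHS]big_nat_recr//= lerDl invr_ge0 exprn_ge0.
Qed.

(** The default 0 of [head] makes the empty list inadmissible. *)
Definition admissible s := (2 <= head 0 s)%N && all (ltn 0) s.

Lemma mzv_cvg s : admissible s -> mzv_trunc s @ \oo --> (mzv s : R).
Proof.
case: s => [//|k s] /andP[/= k2 /andP[_ s0]].
apply: (@sums_to_dominated _ _ (size s) k k2) => n _.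
rewrite mulr_ge0 ?invr_ge0 ?exprn_ge0 ?mzv_trunc_ge0//=.
by rewrite mulrC ler_wpM2r ?invr_ge0 ?exprn_ge0 ?mzv_trunc_le.
Qed.

Lemma nested_sums_to_mzv s i t : admissible (s ++ i :: t) ->
  nested_sums_to s (fun n => n%:R ^- i * mzv_trunc t n : R) (mzv (s ++ i :: t)).
Proof. by move=> a; rewrite /nested_sums_to nested_sum_mzv_trunc; exact: mzv_cvg. Qed.

Lemma nested_sums_to_invX s i : admissible (s ++ [:: i]) ->
  nested_sums_to s (fun n => n%:R ^- i : R) (mzv (s ++ [:: i])).
Proof.
by move/nested_sums_to_mzv; apply: eq_nested_sums_to => n _; rewrite /= mulr1.
Qed.

Lemma prod_gharm_bounds s n : all (ltn 0) s ->
  0 <= (\prod_(k <- s) gharm k n : R) <= gharm 1 n ^+ size s.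
Proof.
elim: s => [|k s IH] /=; first by rewrite big_nil expr0 ler01 lexx.
move=> /andP[k0 /IH /andP[p0 p1]]; rewrite big_cons exprS.
by rewrite mulr_ge0 ?gharm_ge0//= ler_pM ?gharm_ge0 ?gharm_le1.
Qed.

Lemma sums_to_euler_sum s q : all (ltn 0) s -> (2 <= q)%N ->
  sums_to (fun n => (\prod_(k <- s) gharm k n) / n%:R ^+ q : R) (euler_sum s q).
Proof.
move=> s0 q2; apply: (@sums_to_dominated _ _ (size s) q q2) => n _.
have /andP[p0 p1] := prod_gharm_bounds n s0.
by rewrite divr_ge0 ?exprn_ge0//= ler_wpM2r ?invr_ge0 ?exprn_ge0.
Qed.

End Convergence.

(** * Summation by parts and partial fractions *)

Section Telescoping.
Variable R : realType.

(* Summation by parts, the boundary term being killed by the logarithmic growth. *)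
Lemma sums_to_by_parts (f d : nat -> R) r k l :
  f 0 = 0 -> (forall n, f n.+1 = f n + d n.+1) ->
  (forall n, 0 <= f n <= gharm 1 n ^+ r) ->
  sums_to (fun n => d n / (n + k)%:R) l ->
  sums_to (fun n => f n * ((n + k)%:R^-1 - (n + k.+1)%:R^-1)) l.
Proof.
move=> f0 fS fb dl.
have e N : \sum_(1 <= n < N.+1) f n * ((n + k)%:R^-1 - (n + k.+1)%:R^-1)
    = \sum_(1 <= n < N.+1) d n / (n + k)%:R - f N / (N + k.+1)%:R.
  elim: N => [|N IH]; first by rewrite !big_geq// f0 mul0r subr0.
  rewrite big_nat_recr// IH [in RHS]big_nat_recr//= fS addSnnS; ring.
have f_cvg0 : (fun N => f N / (N + k.+1)%:R) @ \oo --> (0 : R).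
  apply: (@squeeze_cvgr _ _ _ _ (fun=> 0) (fun N => gharm 1 N ^+ r / N%:R)).
  (* At [N = 0] the upper bound divides by zero and is 0 by convention, which is enough because
     [f 0 = 0]. *)
  - apply: nearW => -[|N]; first by rewrite f0 mul0r mulr0n invr0 mulr0 lexx.
    have /andP[g0 g1] := fb N.+1; rewrite divr_ge0//= ler_pM// ?invr_ge0//.
    by rewrite lef_pV2 ?posrE ?ltr0n// ler_nat leq_addr.
  - exact: cvg_cst.
  - exact: harm_pow_div_cvg0.
have dl' : (fun N => \sum_(1 <= n < N.+1) d n / (n + k)%:R) @ \oo --> l.
  by rewrite (cvg_shiftS (fun N => \sum_(1 <= n < N) d n / (n + k)%:R)).
rewrite /nested_sums_to/= -cvg_shiftS /mk_sequence.
under eq_fun do rewrite e.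
have : (fun N => \sum_(1 <= n < N.+1) d n / (n + k)%:R - f N / (N + k.+1)%:R)
    @ \oo --> l - 0 by exact: (cvgB dl' f_cvg0).
by rewrite subr0.
Qed.

(** The difference 1/n - 1/(n+k) splits into the k unit steps 1/(n+l) - 1/(n+l+1), each handled by
    summation by parts. *)
Lemma sums_to_telescope (f d v : nat -> R) r k :
  f 0 = 0 -> (forall n, f n.+1 = f n + d n.+1) ->
  (forall n, 0 <= f n <= gharm 1 n ^+ r) ->
  (forall l, (l < k)%N -> sums_to (fun n => d n / (n + l)%:R) (v l)) ->
  sums_to (fun n => f n * (n%:R^-1 - (n + k)%:R^-1)) (\sum_(0 <= l < k) v l).
Proof.
move=> f0 fS fb dv.
have := @nested_sums_to_sum _ [::] 0 k _ v
  (fun l lk => sums_to_by_parts f0 fS fb (dv l lk)).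
apply: eq_nested_sums_to => n _; rewrite -mulr_sumr; congr (_ * _).
elim: k {dv} => [|k IH]; first by rewrite big_geq// addn0 subrr.
by rewrite big_nat_recr//= IH addrA subrK.
Qed.

(** The value of the sum of g(n) / (n^m (n+j)) over n, when [z i] is the sum of g(n) / n^i and [w]
    that of g(n) (1/n - 1/(n+j)). *)
Definition partial_fractions (z : nat -> R) (m j : nat) (w : R) : R :=
  \sum_(1 <= i < m) (-1) ^+ (i - 1) * z (m + 1 - i)%N * j%:R ^- i
  + (-1) ^+ (m - 1) * (j%:R ^- m * w).

(** Mirrors 1/(n^(m+1) (n+j)) = (1/j) (1/n^(m+1) - 1/(n^m (n+j))), the induction step of the next
    lemma. *)
Lemma partial_fractionsS z m j w : (0 < m)%N ->
  partial_fractions z m.+1 j w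
  = j%:R^-1 * (z m.+1 - partial_fractions z m j w).
Proof.
move=> m0; rewrite /partial_fractions big_ltn// subnn expr0 mul1r expr1 addn1 subn1.
have -> : \sum_(2 <= i < m.+1) (-1) ^+ (i - 1) * z (m.+2 - i)%N * j%:R ^- i
    = - j%:R^-1 * \sum_(1 <= i < m) (-1) ^+ (i - 1) * z (m + 1 - i)%N * j%:R ^- i.
  rewrite big_add1 mulr_sumr; apply: eq_big_nat => i /andP[i0 _].
  case: i i0 => // i _; rewrite !subn1 /= !exprS invfM addn1 !subSS; ring.
case: m m0 => // m _; rewrite !subn1/= !exprS !invfM; ring.
Qed.

Lemma sums_to_partial_fractions (g z : nat -> R) w m j :
  (0 < m)%N -> (0 < j)%N ->
  (forall i, (2 <= i <= m)%N -> sums_to (fun n => g n / n%:R ^+ i) (z i)) ->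
  sums_to (fun n => g n * (n%:R^-1 - (n + j)%:R^-1)) w ->
  sums_to (fun n => g n / (n%:R ^+ m * (n + j)%:R)) (partial_fractions z m j w).
Proof.
move=> m0 j0 + gw.
have jN0 : j%:R != 0 :> R by rewrite pnatr_eq0 -lt0n.
have nN0 n : (0 < n)%N -> n%:R != 0 :> R by move=> ?; rewrite pnatr_eq0 -lt0n.
have njN0 n : n%:R + j%:R != 0 :> R.
  by rewrite -natrD pnatr_eq0 addn_eq0 negb_and -!lt0n j0 orbT.
case: m m0 => // m _; elim: m => [|m IH] gz.
  rewrite /partial_fractions big_geq// add0r expr0 mul1r expr1.
  apply: eq_nested_sums_to (@nested_sums_toZ _ _ j%:R^-1 _ _ gw) => n n0.
  by rewrite expr1 natrD; field; rewrite jN0 njN0 nN0.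
rewrite partial_fractionsS//.
have h1 : sums_to (fun n => g n / n%:R ^+ m.+2) (z m.+2) by apply: gz; rewrite leqnn.
have h2 : sums_to (fun n => g n / (n%:R ^+ m.+1 * (n + j)%:R))
    (partial_fractions z m.+1 j w).
  by apply: IH => i /andP[i2 im]; apply: gz; rewrite i2 leqW.
apply: eq_nested_sums_to
  (@nested_sums_toZ _ _ j%:R^-1 _ _ (nested_sums_toB h1 h2)) => n n0.
by rewrite natrD !exprS; field; rewrite jN0 njN0 expf_neq0 nN0.
Qed.

End Telescoping.

(** * Evaluation of the shifted series and of the double series *)

Section Evaluation.
Variable R : realType.
Implicit Types (s : seq nat).

Lemma admissible_cat s t : admissible s -> all (ltn 0) t -> admissible (s ++ t).
Proof.
case: s => [//|k s] /andP[/= k2 /andP[k0 s0]] t0.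
by rewrite /admissible/= k2 k0 all_cat s0.
Qed.

(** This and the next two definitions are closed forms, for j > 0, of the sums over n of 1/(n^p
    (n+j)), of H_n^(p) (1/n - 1/(n+j)), and of H_n^(p) / (n^m (n+j)). *)
Definition zeta_shift p j : R :=
  partial_fractions (fun i => mzv [:: i]) p j (gharm 1 j).

Definition harm_shift p j : R :=
  mzv [:: (p + 1)%N] + \sum_(1 <= l < j) zeta_shift p l.

Definition euler_shift p m j : R :=
  partial_fractions (fun i => euler_sum [:: p] i) m j (harm_shift p j).

(** Telescoping for the function that is 1 at n >= 1 but 0 at n = 0, as [sums_to_telescope] demands;
    its increment is the indicator of n = 1, so the l-th piece is 1/(1+l). *)
Lemma sums_to_gharm1 k :
  sums_to (fun n => n%:R^-1 - (n + k)%:R^-1 : R) (gharm 1 k).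
Proof.
rewrite /gharm big_add1/=.
apply: (@eq_nested_sums_to _ _ (fun n => (0 < n)%:R * (n%:R^-1 - (n + k)%:R^-1))).
  by move=> n ->; rewrite mul1r.
apply: (@sums_to_telescope _ _ (fun n => (n == 1)%:R) _ 0) => //.
- by case=> [|n]; rewrite ?add0r// addr0.
- by case=> [|n]; rewrite expr0 ?ler01 ?lexx.
move=> l _; rewrite expr1 /nested_sums_to/=.
apply: cvg_near_cst; exists 2%N => //= N N2.
rewrite big_ltn//= mul1r add1n big_nat big1 ?addr0// => n /andP[n2 _].
by case: n n2 => [|[|n]]//; rewrite mul0r.
Qed.

Lemma sums_to_zeta_shift p j : (0 < p)%N -> (0 < j)%N ->
  sums_to (fun n => (n%:R ^+ p * (n + j)%:R)^-1) (zeta_shift p j).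
Proof.
move=> p0 j0.
apply: (@eq_nested_sums_to _ _ (fun n => 1 / (n%:R ^+ p * (n + j)%:R))).
  by move=> n _; rewrite mul1r.
apply: (@sums_to_partial_fractions _ (fun=> 1)) => //.
  move=> i /andP[i2 _]; have := @nested_sums_to_invX R [::] i.
  rewrite /admissible/= i2 (ltnW i2) => /(_ isT) h.
  by apply: eq_nested_sums_to h => n _; rewrite mul1r.
by apply: eq_nested_sums_to (@sums_to_gharm1 j) => n _; rewrite mul1r.
Qed.

Lemma sums_to_harm_shift p j : (0 < p)%N -> (0 < j)%N ->
  sums_to (fun n => gharm p n * (n%:R^-1 - (n + j)%:R^-1)) (harm_shift p j).
Proof.
(* Shift 0 is separate: there the summand is n^-(p+1), while the closed form [zeta_shift] would
   divide by zero. *)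
move=> p0 j0; pose v l := if l is 0 then mzv [:: (p + 1)%N] else zeta_shift p l.
have -> : harm_shift p j = \sum_(0 <= l < j) v l.
  rewrite big_ltn//; congr (_ + _); apply: eq_big_nat => l /andP[].
  by case: l.
apply: (@sums_to_telescope _ _ (fun n => n%:R ^- p) _ 1).
- exact: gharm0.
- exact: gharmS.
- by move=> n; rewrite gharm_ge0 expr1 gharm_le1.
case=> [|l] _.
  have := @nested_sums_to_invX R [::] (p + 1).
  rewrite /admissible/= addn1 ltnS p0 => /(_ isT).
  by apply: eq_nested_sums_to => n _; rewrite addn0 exprSr invfM mulrC.
by apply: eq_nested_sums_to (sums_to_zeta_shift p0 (ltn0Sn l)) => n _; rewrite invfM.
Qed.

Lemma sums_to_euler_shift p m j : (0 < p)%N -> (0 < m)%N -> (0 < j)%N ->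
  sums_to (fun n => gharm p n / (n%:R ^+ m * (n + j)%:R)) (euler_shift p m j).
Proof.
move=> p0 m0 j0; apply: sums_to_partial_fractions => //; last exact: sums_to_harm_shift.
move=> i /andP[i2 _]; have := @sums_to_euler_sum R [:: p] i.
rewrite /= p0 => /(_ isT i2); apply: eq_nested_sums_to => n _.
by rewrite big_seq1.
Qed.

(** Telescoping for a product: its increment is a da' + a' da - da da' in terms of the new values a,
    a' and their increments, the last term correcting the double count. *)
Lemma sums_to_harm2_shift p q k : (0 < p)%N -> (0 < q)%N -> (0 < k)%N ->
  sums_to (fun n => gharm p n * gharm q n * (n%:R^-1 - (n + k)%:R^-1))
    (euler_sum [:: p] (q + 1) + euler_sum [:: q] (p + 1) - mzv [:: (p + q + 1)%N]
     + \sum_(1 <= j < k)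
        (euler_shift p q j + euler_shift q p j - zeta_shift (p + q) j)).
Proof.
move=> p0 q0 k0.
pose v l := if l is 0 then euler_sum [:: p] (q + 1) + euler_sum [:: q] (p + 1)
    - mzv [:: (p + q + 1)%N]
  else euler_shift p q l + euler_shift q p l - zeta_shift (p + q) l.
have -> : \sum_(1 <= j < k)
    (euler_shift p q j + euler_shift q p j - zeta_shift (p + q) j)
    = \sum_(1 <= l < k) v l.
  by apply: eq_big_nat => -[].
rewrite -(@big_ltn _ _ _ 0 k v k0).
apply: (@sums_to_telescope _ _
  (fun n => gharm p n / n%:R ^+ q + gharm q n / n%:R ^+ p - n%:R ^- (p + q)) _ 2).
- by rewrite gharm0 mul0r.
- by move=> n; rewrite !gharmS exprD invfM; ring.
- by move=> n; rewrite mulr_ge0 ?gharm_ge0//= expr2 ler_pM ?gharm_ge0 ?gharm_le1.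
case=> [|l] _.
  have h m i : (0 < m)%N -> (0 < i)%N ->
      sums_to (fun n => gharm m n / n%:R ^+ i / n%:R : R) (euler_sum [:: m] (i + 1)).
    move=> m0 i0; have := @sums_to_euler_sum R [:: m] (i + 1).
    rewrite /= m0 addn1 ltnS i0 => /(_ isT isT); apply: eq_nested_sums_to => n _.
    by rewrite big_seq1 exprSr invfM mulrA.
  have h' := @nested_sums_to_invX R [::] (p + q + 1).
  move: h'; rewrite /admissible/= addn1 ltnS addn_gt0 p0/= => /(_ isT) h'.
  apply: eq_nested_sums_to
    (nested_sums_toB (nested_sums_toD (h p q p0 q0) (h q p q0 p0)) h') => n _.
  by rewrite addn0 exprSr invfM !mulrDl mulNr; congr (_ - _); rewrite mulrC.
have pq0 : (0 < p + q)%N by rewrite addn_gt0 p0.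
apply: eq_nested_sums_to (nested_sums_toB (nested_sums_toD
  (sums_to_euler_shift p0 q0 (ltn0Sn l)) (sums_to_euler_shift q0 p0 (ltn0Sn l)))
  (sums_to_zeta_shift pq0 (ltn0Sn l))) => n _.
by rewrite !invfM !mulrDl mulNr !mulrA.
Qed.

(** The shift j becomes the next summation index below those of [s], so each power j^-i appends the
    exponent i. *)
Lemma nested_sums_to_partial_fractions s (z : nat -> R) p (w : nat -> R) l :
  admissible s -> nested_sums_to s (fun j => j%:R ^- p * w j) l ->
  nested_sums_to s (fun j => partial_fractions z p j (w j))
    (\sum_(1 <= i < p) (-1) ^+ (i - 1) * z (p + 1 - i)%N * mzv (s ++ [:: i])
     + (-1) ^+ (p - 1) * l).
Proof.
move=> s_adm wl; apply: nested_sums_toD; last exact: nested_sums_toZ.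
apply: nested_sums_to_sum => i /andP[i0 _]; apply: nested_sums_toZ.
by apply: nested_sums_to_invX; apply: admissible_cat; rewrite //= i0.
Qed.

Definition mzv_zeta_shift s p : R :=
  \sum_(1 <= i < p) (-1) ^+ (i - 1) * mzv [:: (p + 1 - i)%N] * mzv (s ++ [:: i])
  + (-1) ^+ (p - 1) * (mzv (s ++ [:: p; 1]%N) + mzv (s ++ [:: (p + 1)%N])).

Lemma nested_sums_to_zeta_shift s p : admissible s -> (0 < p)%N ->
  nested_sums_to s (zeta_shift p) (mzv_zeta_shift s p).
Proof.
move=> s_adm p0.
apply: (@nested_sums_to_partial_fractions s (fun i => mzv [:: i]) p) => //.
have h1 := @nested_sums_to_mzv R s p [:: 1%N].
have h2 := @nested_sums_to_invX R s (p + 1).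
apply: eq_nested_sums_to (nested_sums_toD (h1 _) (h2 _)) => [n n0||].
(* Nested sums use strict inequalities, so the last term 1/n of H_n is split off: it raises the
   exponent p to p + 1, and the rest is a further index with exponent 1. *)
- rewrite addn1 exprSr invfM -mulrDr; congr (_ * _); rewrite /gharm big_nat_recr//= expr1.
  by congr (_ + _); apply: eq_bigr => i _; rewrite mulr1.
- by apply: admissible_cat; rewrite //= p0.
- by apply: admissible_cat; rewrite //= addn1.
Qed.

(** An inner sum over j < k weighted by k^-p is one more level of nesting, so p moves from the
    summand into the list of exponents. *)
Lemma nested_sums_to_rcons s p c (e : nat -> R) l :
  admissible (rcons s p) -> nested_sums_to (rcons s p) e l ->
  nested_sums_to s (fun k => k%:R ^- p * (c + \sum_(1 <= j < k) e j))
    (c * mzv (rcons s p) + l).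
Proof.
move=> sp_adm el; have h := @nested_sums_to_invX R s p.
move: h; rewrite cats1 => /(_ sp_adm) h.
rewrite /nested_sums_to nested_sum_rcons in el.
apply: eq_nested_sums_to (nested_sums_toD (@nested_sums_toZ _ _ c _ _ h) el) => k _.
by rewrite mulrDr [c * _]mulrC.
Qed.

Definition mzv_euler_shift s p m : R :=
  \sum_(1 <= i < m)
     (-1) ^+ (i - 1) * euler_sum [:: p] (m + 1 - i) * mzv (s ++ [:: i])
  + (-1) ^+ (m - 1)
    * (mzv [:: (p + 1)%N] * mzv (rcons s m) + mzv_zeta_shift (rcons s m) p).

Lemma nested_sums_to_euler_shift s p m :
  admissible s -> (0 < p)%N -> (0 < m)%N ->
  nested_sums_to s (euler_shift p m) (mzv_euler_shift s p m).
Proof.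
move=> s_adm p0 m0.
apply: (@nested_sums_to_partial_fractions s (fun i => euler_sum [:: p] i) m) => //.
have sm_adm : admissible (rcons s m).
  by rewrite -cats1; apply: admissible_cat; rewrite //= m0.
exact: nested_sums_to_rcons (nested_sums_to_zeta_shift sm_adm p0).
Qed.

(* Both sides are the double series of H_n^(p) H_n^(q) / (n k^(m-1) (n+k)),
   summed by rows on the left and by columns on the right. *)
Lemma euler_sum_1_double_series p q m : (0 < p)%N -> (0 < q)%N -> (1 < m)%N ->
  \sum_(1 <= i < m.-1)
     (-1) ^+ (i - 1) * mzv [:: (m - i)%N] * euler_sum [:: p; q] (i + 1)
  + (-1) ^+ m * euler_sum [:: 1; p; q]%N m
  = (euler_sum [:: p] (q + 1) + euler_sum [:: q] (p + 1) - mzv [:: (p + q + 1)%N])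
      * mzv [:: m]
    + (mzv_euler_shift [:: m] p q + mzv_euler_shift [:: m] q p
       - mzv_zeta_shift [:: m] (p + q)) :> R.
Proof.
move=> p0 q0 m1; pose f n : R := gharm p n * gharm q n.
have f0 n : 0 <= f n by rewrite mulr_ge0 ?gharm_ge0.
have m_adm : admissible [:: m] by rewrite /admissible/= m1 ltnW.
have m'0 : (0 < m.-1)%N by case: m m1 {m_adm} => [|[]].
have pq0 : (0 < p + q)%N by rewrite addn_gt0 p0.
apply: (@sums_to_exchange _ (fun n k => f n / n%:R * (k%:R ^+ m.-1 * (k + n)%:R)^-1)
  (fun n => f n / n%:R * zeta_shift m.-1 n)
  (fun k => k%:R ^- m * (euler_sum [:: p] (q + 1) + euler_sum [:: q] (p + 1)
     - mzv [:: (p + q + 1)%N] + \sum_(1 <= j < k)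
        (euler_shift p q j + euler_shift q p j - zeta_shift (p + q) j)))).
- move=> n k _ _; apply: mulr_ge0; first by apply: divr_ge0.
  by rewrite invr_ge0; apply: mulr_ge0; rewrite ?exprn_ge0.
- by move=> n n0; apply: nested_sums_toZ; exact: sums_to_zeta_shift.
(* Columns: 1/(n k^(m-1) (n+k)) = k^-m (1/n - 1/(n+k)). *)
- move=> k k0; apply: eq_nested_sums_to
    (@nested_sums_toZ _ _ (k%:R ^- m) _ _ (sums_to_harm2_shift p0 q0 k0)) => n n0.
  rewrite -/(f n); case: m m1 {m_adm m'0} => // m _ /=.
  have n_neq0 : n%:R != 0 :> R by rewrite pnatr_eq0 -lt0n.
  have k_neq0 : k%:R != 0 :> R by rewrite pnatr_eq0 -lt0n.
  have nk_neq0 : n%:R + k%:R != 0 :> R.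
    by rewrite -natrD pnatr_eq0 -lt0n addn_gt0 n0.
  rewrite exprS !natrD [k%:R + _]addrC; field.
  by rewrite nk_neq0 n_neq0 k_neq0 expf_neq0.
(* Rows: the last term of [zeta_shift m.-1 n] carries H_n / n^(m-1), which produces the Euler sum
   with the extra index 1; the other terms give zeta values times quadratic Euler sums. *)
- have h : sums_to (fun n => f n / n%:R * zeta_shift m.-1 n)
      (\sum_(1 <= i < m.-1) (-1) ^+ (i - 1) * mzv [:: (m.-1 + 1 - i)%N]
         * euler_sum [:: p; q] (i + 1)
       + (-1) ^+ (m.-1 - 1) * euler_sum [:: 1; p; q]%N m).
    have h1 := @sums_to_euler_sum R [:: 1; p; q]%N m.
    rewrite /= p0 q0 in h1.
    have h2 : sums_to (fun n => \sum_(1 <= i < m.-1) (-1) ^+ (i - 1)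
          * mzv [:: (m.-1 + 1 - i)%N]
          * ((\prod_(k <- [:: p; q]) gharm k n) / n%:R ^+ (i + 1)) : R)
        (\sum_(1 <= i < m.-1) (-1) ^+ (i - 1) * mzv [:: (m.-1 + 1 - i)%N]
         * euler_sum [:: p; q] (i + 1)).
      apply: nested_sums_to_sum => i /andP[i0 _].
      apply: nested_sums_toZ.
      by apply: sums_to_euler_sum; rewrite /= ?p0 ?q0// addn1.
    apply: eq_nested_sums_to (nested_sums_toD h2
      (@nested_sums_toZ _ _ ((-1) ^+ (m.-1 - 1)) _ _ (h1 isT m1))) => n n0.
    rewrite /zeta_shift /partial_fractions mulrDr mulr_sumr; congr (_ + _).
      apply: eq_bigr => i _; rewrite !big_cons big_nil mulr1 -/(f n) exprD expr1 invfM.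
      ring.
    have -> : n%:R ^- m = n%:R^-1 * n%:R ^- m.-1 :> R.
      by rewrite -invfM -exprS prednK// ltnW.
    rewrite !big_cons big_nil mulr1 -/(f n); ring.
  move: h; have -> : (-1) ^+ (m.-1 - 1) = (-1) ^+ m :> R.
    by case: m m1 {m_adm m'0} => [|[|m]]//= _; rewrite subn1/= !exprS; ring.
  by rewrite addn1 (prednK (ltnW m1)).
(* The column values have the form k^-m (constant + sum over j < k), so m becomes the outermost
   exponent. *)
- apply: (@nested_sums_to_rcons [::] m) => //.
  by apply: nested_sums_toB; [apply: nested_sums_toD|];
    [exact: nested_sums_to_euler_shift| exact: nested_sums_to_euler_shift|
     exact: nested_sums_to_zeta_shift].
Qed.

End Evaluation.

(** * The cubic Euler sum isolated from the double series identity *)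

Theorem theorem2p3 (R : realType) (m1 m2 m3 : nat)
    (hm1 : (1 <= m1)%N) (hm2 : (1 <= m2)%N) (hm3 : (2 <= m3)%N) :
  (euler_sum [:: 1; m1; m2]%N m3 : R) =
    (-1) ^+ (m3 - 1) *
      (\sum_(1 <= i < (m3 - 2).+1)
         (-1) ^+ (i - 1) * mzv [:: m3 - i]%N * euler_sum [:: m1; m2] (i + 1))
  + (-1) ^+ m3 *
      (euler_sum [:: m1] (m2 + 1) + euler_sum [:: m2] (m1 + 1)
       - mzv [:: m1 + m2 + 1]%N) * mzv [:: m3]
  + (-1) ^+ m3 *
      ((\sum_(1 <= i < (m2 - 1).+1)
          (-1) ^+ (i - 1) * euler_sum [:: m1] (m2 + 1 - i) * mzv [:: m3; i])
       + (\sum_(1 <= i < (m1 - 1).+1)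
          (-1) ^+ (i - 1) * euler_sum [:: m2] (m1 + 1 - i) * mzv [:: m3; i]))
  + (-1) ^+ m3 *
      ((-1) ^+ (m2 - 1) * mzv [:: m1 + 1]%N * mzv [:: m3; m2]
       + (-1) ^+ (m1 - 1) * mzv [:: m2 + 1]%N * mzv [:: m3; m1])
  + (-1) ^+ m3 *
      ((-1) ^+ (m2 - 1) *
         (\sum_(1 <= i < (m1 - 1).+1)
            (-1) ^+ (i - 1) * mzv [:: m1 + 1 - i]%N * mzv [:: m3; m2; i])
       + (-1) ^+ (m1 - 1) *
         (\sum_(1 <= i < (m2 - 1).+1)
            (-1) ^+ (i - 1) * mzv [:: m2 + 1 - i]%N * mzv [:: m3; m1; i]))
  + (-1) ^+ (m1 + m2 + m3) *
      (mzv [:: m3; m2; m1; 1]%N + mzv [:: m3; m1; m2; 1]%N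
       + mzv [:: m3; m2; m1 + 1]%N + mzv [:: m3; m1; m2 + 1]%N
       + mzv [:: m3; m1 + m2; 1]%N + mzv [:: m3; m1 + m2 + 1]%N)
  - (-1) ^+ m3 *
      (\sum_(1 <= i < (m1 + m2 - 1).+1)
         (-1) ^+ (i - 1) * mzv [:: m1 + m2 + 1 - i]%N * mzv [:: m3; i]).
Proof.
have := @euler_sum_1_double_series R m1 m2 m3 hm1 hm2 hm3.
rewrite /mzv_euler_shift /mzv_zeta_shift /=.
have sgnB1 m : (0 < m)%N -> (-1) ^+ (m - 1) = - (-1) ^+ m :> R.
  by case: m => // m _; rewrite subn1 exprS mulN1r opprK.
have subSK m : (0 < m)%N -> (m - 1).+1 = m by move=> m0; rewrite subn1 prednK.
have hm12 : (0 < m1 + m2)%N by rewrite addn_gt0 hm1.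
have -> : (m3 - 2).+1 = m3.-1 by rewrite -(subSn hm3) subSS subn1.
have hm3' := ltnW hm3; rewrite !subSK// !sgnB1// !exprD.
have := sqrr_sign R m3.
move: ((-1) ^+ m1) ((-1) ^+ m2) ((-1) ^+ m3) => a b c c1.
set S := euler_sum _ m3; set A := \sum_(1 <= i < m3.-1) _.
(* Subtracting [A] and multiplying by the sign [c], whose square is 1, isolates [S]; what remains is
   a polynomial identity in the signs [a], [b], [c]. *)
move=> /(congr1 (fun x => c * (x - A))).
rewrite [A + _]addrC addrK mulrA -expr2 c1 mul1r => ->.
ring.
Qed.
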